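(* As $m\to\infty$, the functionals $\widetilde{\Phi}^{(m)}\circ j^{(m)}$ on $\mathcal{A}_1*\mathcal{A}_2$ converge pointwise to the conditionally free product of states $*_{i\in\{1,2\}}(\phi_i,\psi_i)$; that is, for every $x\in\mathcal{A}_1*\mathcal{A}_2$, $$\lim_{m\to\infty}\left(\widetilde{\Phi}^{(m)}\circ j^{(m)}\right)(x)=\left( *_{i\in\{1,2\}}(\phi_i,\psi_i)\right)(x).$$
   Context: Algebras and states. For $l=1,2$, $\mathcal{A}_l$ is the unital free *-algebra over $\mathbb{C}$ generated by a set $\mathcal{G}_l^+$: with $\mathcal{G}_l^-=\{a^*: a\in\mathcal{G}_l^+\}$ and $\mathcal{G}_l=\mathcal{G}_l^+\cup\mathcal{G}_l^-$, it is the free unital algebra on the letters $\mathcal{G}_l$, with words $a_1\ldots a_k$ ($a_i\in\mathcal{G}_l$) as linear basis, the empty word being the unit $\mathbf{1}$, and involution the antilinear extension of $(a_1\ldots a_k)^*=a_k^*\ldots a_1^*$. A state on a unital *-algebra is a linear functional $\phi$ with $\phi(\mathbf{1})=1$ and $\phi(xx^* )\ge 0$ for all $x$. $\phi_l,\psi_l$ are states on $\mathcal{A}_l$. Boolean extension. $\widetilde{\mathcal{A}}_l=\mathcal{A}_l*\mathbb{C}[t]$ is the free product with units identified, $t=t^*$. For a state $\phi$ on $\mathcal{A}_l$, its Boolean extension $\widetilde{\phi}$ is the state on $\widetilde{\mathcal{A}}_l$ which is the linear extension of $\widetilde{\phi}(\mathbf{1})=1$ (more generally $\widetilde\phi(t^r)=1$)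 and $\widetilde{\phi}(t_0w_1t_1\ldots w_nt_n)=\phi(w_1)\ldots\phi(w_n)$, where $w_1,\ldots,w_n$ are non-empty words in $\mathcal{A}_l$ and $t_0,\ldots,t_n$ are powers of $t$, of which $t_1,\ldots,t_{n-1}\neq\mathbf{1}$. Tensor product space. $\widetilde{\mathcal{A}}^{(m)}=\widetilde{\mathcal{A}}_1^{\otimes m}\otimes\widetilde{\mathcal{A}}_2^{\otimes m}$ (algebraic tensor product, componentwise involution), with state $\widetilde{\Phi}^{(m)}=\widetilde{\phi}_1\otimes\widetilde{\psi}_1^{\otimes(m-1)}\otimes\widetilde{\phi}_2\otimes\widetilde{\psi}_2^{\otimes(m-1)}$. Put $I_k=\mathbf{1}^{\otimes k}$; for $x\in\widetilde{\mathcal{A}}_l$ and $1\le k\le m$ let $i_{k,m}(x)=I_{k-1}\otimes x\otimes I_{m-k}\in\widetilde{\mathcal{A}}_l^{\otimes m}$, with the convention $i_{m+1,m}(a)=0$; and $t_{[k,m]}=I_{k-1}\otimes t^{\otimes(m-k+1)}$. The homomorphism. For $a\in\mathcal{G}_1$, $b\in\mathcal{G}_2$, $$j_1^{(m)}(a)=\sum_{k=1}^m(i_{k,m}(a)-i_{k+1,m}(a))\otimes t_{[k,m]},\qquad j_2^{(m)}(b)=\sum_{k=1}^m t_{[k,m]}\otimes(i_{k,m}(b)-i_{k+1,m}(b)).$$ $j^{(m)}:\mathcal{A}_1*\mathcal{A}_2\to\widetilde{\mathcal{A}}^{(m)}$ (free product with identified units) is the unital *-homomorphism with $j^{(m)}(a)=j_l^{(m)}(a)$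 for $a\in\mathcal{G}_l$, $l=1,2$. Conditionally free product. $\phi=*_{i\in\{1,2\}}(\phi_i,\psi_i)$ is the state on $\mathcal{A}_1*\mathcal{A}_2$ determined by $\phi(\mathbf{1})=1$ and $\phi(a_1\ldots a_n)=\phi_{k_1}(a_1)\ldots\phi_{k_n}(a_n)$ whenever $a_j\in\mathcal{A}_{k_j}$, $\psi_{k_j}(a_j)=0$ and $k_1\ne k_2\ne\cdots\ne k_n$. *)

(* Defs.v *)
From HB Require Import structures.
From mathcomp Require Import all_boot all_order all_algebra.
From mathcomp Require Import finmap.
From mathcomp Require Import all_classical all_reals topology normedtype.
From mathcomp Require Import complex.
(* The notations of monalg are incompatible with those of the analysis files. *)
From mathcomp Require Import -(notations) monalg.

Set Implicit Arguments.
Unset Strict Implicit.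
Unset Printing Implicit Defensive.

Import Order.TTheory GRing.Theory Num.Theory.
Import numFieldNormedType.Exports.

Local Open Scope ring_scope.

(* All constructions are made over a numClosedFieldType C; the complex numbers *)
(* are C = R[i] with R : realType.                                            *)

(* Direct products of monoids.  They index the bases of tensor products:      *)
(* C[M] (x) C[N] = C[M x N] and C[M]^(x) m = C[M^m].                          *)
Section FfunMonom.
Variables (I : finType) (M : monomType).
Implicit Types f g : {ffun I -> M}.

Definition ffun_mone : {ffun I -> M} := [ffun=> mone].
Definition ffun_mmul f g : {ffun I -> M} := [ffun i => mmul (f i) (g i)].

Fact ffun_mmulA : associative ffun_mmul.
Proof. by move=> f g h; apply/ffunP => i; rewrite !ffunE mulmA. Qed.

Fact ffun_mul1m : left_id ffun_mone ffun_mmul.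
Proof. by move=> f; apply/ffunP => i; rewrite !ffunE mul1m. Qed.

Fact ffun_mulm1 : right_id ffun_mone ffun_mmul.
Proof. by move=> f; apply/ffunP => i; rewrite !ffunE mulm1. Qed.

Fact ffun_unitm f g :
  ffun_mmul f g = ffun_mone -> f = ffun_mone /\ g = ffun_mone.
Proof.
move=> /ffunP fg1; split; apply/ffunP => i; have := fg1 i; rewrite !ffunE;
  by case/unitm.
Qed.

HB.instance Definition _ := Choice_isMonomialDef.Build {ffun I -> M}
  ffun_mmulA ffun_mul1m ffun_mulm1 ffun_unitm.
End FfunMonom.

Section ProdMonom.
Variables M N : monomType.
Implicit Types p q : (M * N)%type.

Definition prod_mone : (M * N)%type := (mone, mone).
Definition prod_mmul p q : (M * N)%type := (mmul p.1 q.1, mmul p.2 q.2).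

Fact prod_mmulA : associative prod_mmul.
Proof. by move=> [a b] [c d] [e f]; rewrite /prod_mmul /= !mulmA. Qed.

Fact prod_mul1m : left_id prod_mone prod_mmul.
Proof. by move=> [a b]; rewrite /prod_mmul /= !mul1m. Qed.

Fact prod_mulm1 : right_id prod_mone prod_mmul.
Proof. by move=> [a b]; rewrite /prod_mmul /= !mulm1. Qed.

Fact prod_unitm p q :
  prod_mmul p q = prod_mone -> p = prod_mone /\ q = prod_mone.
Proof. by case: p q => [a b] [c d] [] /unitm[-> ->] /unitm[-> ->]. Qed.

HB.instance Definition _ := Choice_isMonomialDef.Build (M * N)%type
  prod_mmulA prod_mul1m prod_mulm1 prod_unitm.
End ProdMonom.

Section MonoidAlgebra.
Variable C : numClosedFieldType.

(* malg M C is the monoid algebra C[M]; base w is the basis element w.        *)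
Definition base (M : choiceType) (w : M) : malg M C := mkmalgU w 1.

Definition lin_ext (M : choiceType) (V : lmodType C) (h : M -> V)
    (x : malg M C) : V :=
  \sum_(w <- msupp x) mcoeff w x *: h w.

(* The antilinear extension of s, which is meant to be an involution of the    *)
(* basis M that reverses products.                                            *)
Definition star (M : choiceType) (s : M -> M) (x : malg M C) :
    malg M C :=
  \sum_(w <- msupp x) mkmalgU (s w) (mcoeff w x)^*.

(* The tensor product of x and y, in C[M] (x) C[N] = C[M x N].                *)
Definition tensor (M N : choiceType) (x : malg M C) (y : malg N C) :
    malg (M * N)%type C :=
  \sum_(u <- msupp x) \sum_(v <- msupp y)
     mkmalgU (u, v) (mcoeff u x * mcoeff v y).

Definition is_state (M : monomType) (s : M -> M)
    (phi : {scalar malg M C}) : Prop :=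
  phi 1 = 1 /\ forall x, 0 <= phi (x * star s x).

Section LinExt.
Variables (M : choiceType) (V : lmodType C) (h : M -> V).

Lemma lin_extEw (d : {fset M}) (x : malg M C) : fsubset (msupp x) d ->
  lin_ext h x = \sum_(w <- d) mcoeff w x *: h w.
Proof.
move=> xd; rewrite /lin_ext (big_fset_incl _ xd) //= => w _ /mcoeff_outdom ->.
by rewrite scale0r.
Qed.

Lemma lin_ext_is_linear : linear (lin_ext h).
Proof.
move=> c x y; pose d := fsetU (msupp x) (msupp y).
rewrite (@lin_extEw d); last first.
  apply: fsubset_trans (msuppD_le _ _) _; apply: fsetSU; exact: msuppZ_le.
rewrite (@lin_extEw d x) ?fsubsetUl // (@lin_extEw d y) ?fsubsetUr //.
rewrite scaler_sumr -big_split /=; apply: eq_bigr => w _.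
by rewrite mcoeffD mcoeffZ scalerDl scalerA.
Qed.

HB.instance Definition _ :=
  GRing.isLinear.Build C (malg M C) V _ (lin_ext h) lin_ext_is_linear.

Lemma lin_ext0 : lin_ext h 0 = 0.
Proof. exact: linear0. Qed.

Lemma lin_extD : {morph lin_ext h : x y / x + y}.
Proof. exact: linearD. Qed.

Lemma lin_extZ c x : lin_ext h (c *: x) = c *: lin_ext h x.
Proof. exact: linearZ. Qed.

Lemma lin_extU w c : lin_ext h (mkmalgU w c) = c *: h w.
Proof.
by rewrite (lin_extEw (@msuppU_le _ _ w c)) big_seq_fset1 mcoeffUU.
Qed.

Lemma lin_ext_base w : lin_ext h (base w) = h w.
Proof. by rewrite lin_extU scale1r. Qed.
End LinExt.

Lemma base1 (M : monomType) : base (mone : M) = 1.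
Proof. by []. Qed.

Lemma baseM (M : monomType) (u v : M) : base (mmul u v) = base u * base v.
Proof.
by rewrite malgME !msuppU1 !big_seq_fset1 !mcoeffUU mulr1.
Qed.

Lemma lin_ext1 (M : monomType) (V : lalgType C) (h : M -> V) :
  h mone = 1 -> lin_ext h 1 = 1.
Proof. by move=> h1; rewrite -[RHS]h1 -base1 lin_ext_base. Qed.

Lemma mcoeff_star (M : choiceType) (s : M -> M) (x : malg M C) w :
  involutive s -> mcoeff w (star s x) = (mcoeff (s w) x)^*.
Proof.
move=> sK; rewrite /star raddf_sum /=.
under eq_bigr do rewrite mcoeffU (can2_eq sK sK).
have [wx|wx] := msuppP x (s w).
  rewrite (big_fsetD1 (s w)) //= eqxx mulr1n big1_fset ?addr0 // => v.
  by rewrite in_fsetD1 => /andP[/negPf ->].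
rewrite rmorph0 big_seq big1 // => v vx.
by case: eqP => // vw; rewrite -vw vx in wx.
Qed.

Lemma mcoeff_tensor (M N : choiceType) (x : malg M C) (y : malg N C) u v :
  mcoeff (u, v) (tensor x y) = mcoeff u x * mcoeff v y.
Proof.
rewrite [in RHS](monalgE x) [in RHS](monalgE y) !raddf_sum /= mulr_suml.
apply: eq_bigr => u' _; rewrite raddf_sum mulr_sumr; apply: eq_bigr => v' _.
by rewrite /= !mcoeffU xpair_eqE -mulnb mulrnA mulrnAr mulrnAl.
Qed.

Lemma malg_ind (M : choiceType) (P : malg M C -> Prop) :
  P 0 -> (forall x y, P x -> P y -> P (x + y)) ->
  (forall w c, P (mkmalgU w c)) -> forall x, P x.
Proof. by move=> P0 PD PU x; rewrite [x]monalgE; apply: big_ind. Qed.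

Lemma mulUU (M : monomType) (u v : M) (a b : C) :
  mkmalgU u a * mkmalgU v b = mkmalgU (mmul u v) (a * b).
Proof. by rewrite malgM_def fgmulUU. Qed.

Lemma scaleU (M : choiceType) c (w : M) a :
  c *: mkmalgU w a = mkmalgU w (c * a) :> malg M C.
Proof. by apply/malgP => v; rewrite mcoeffZ !mcoeffU mulrnAr. Qed.

Lemma malg_scalerAr (M : monomType) c (x y : malg M C) :
  c *: (x * y) = x * (c *: y).
Proof.
elim/malg_ind: x => [|x1 x2 IH1 IH2|u a]; first by rewrite !mul0r scaler0.
  by rewrite mulrDl scalerDr IH1 IH2 -mulrDl.
elim/malg_ind: y => [|y1 y2 IH1 IH2|v b].
- by rewrite scaler0 !mulr0 scaler0.
- by rewrite scalerDr 2!mulrDr scalerDr IH1 IH2.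
by rewrite mulUU !scaleU mulUU mulrCA.
Qed.

Lemma lin_extM (M N : monomType) (h : M -> malg N C) :
  {morph h : u v / mmul u v >-> u * v} -> {morph lin_ext h : x y / x * y}.
Proof.
move=> hM x y; elim/malg_ind: x => [|x1 x2 IH1 IH2|u a].
- by rewrite mul0r lin_ext0 mul0r.
- by rewrite mulrDl 2!lin_extD IH1 IH2 mulrDl.
elim/malg_ind: y => [|y1 y2 IH1 IH2|v b].
- by rewrite mulr0 lin_ext0 mulr0.
- by rewrite mulrDr 2!lin_extD IH1 IH2 mulrDr.
by rewrite mulUU !lin_extU hM -malg_scalerAr -scalerAl scalerA mulrC.
Qed.

Section Star.
Variables (M : choiceType) (s : M -> M).
Hypothesis sK : involutive s.

Lemma starD : {morph @star M s : x y / x + y}.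
Proof.
move=> x y; apply/malgP => w; rewrite mcoeffD !mcoeff_star //.
by rewrite mcoeffD rmorphD.
Qed.

Lemma star0 : star s 0 = 0.
Proof. by apply/malgP => w; rewrite mcoeff_star // !mcoeff0 rmorph0. Qed.

Lemma starN : {morph @star M s : x / - x}.
Proof.
by move=> x; apply/malgP => w; rewrite mcoeffN !mcoeff_star // mcoeffN rmorphN.
Qed.

Lemma starZ c x : star s (c *: x) = c^* *: star s x.
Proof.
by apply/malgP => w; rewrite mcoeffZ !mcoeff_star // mcoeffZ rmorphM.
Qed.

Lemma starU w c : star s (mkmalgU w c) = mkmalgU (s w) c^*.
Proof.
apply/malgP => v; rewrite mcoeff_star // !mcoeffU rmorphMn.
by rewrite (can2_eq sK sK).
Qed.

Lemma star_base w : star s (base w) = base (s w).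
Proof. by rewrite starU rmorph1. Qed.

Lemma star_sum (I : Type) (r : seq I) (P : pred I) (F : I -> malg M C) :
  star s (\sum_(i <- r | P i) F i) = \sum_(i <- r | P i) star s (F i).
Proof. exact: (big_morph _ starD star0). Qed.
End Star.

Lemma starM (M : monomType) (s : M -> M) :
  involutive s -> {morph s : u v / mmul u v >-> mmul v u} ->
  {morph @star M s : x y / x * y >-> y * x}.
Proof.
move=> sK sM x y; rewrite (malgME x y) star_sum // [in RHS]/star mulr_sumr.
apply: eq_bigr => u _; rewrite star_sum // mulr_suml.
by apply: eq_bigr => v _; rewrite mulUU starU // sM rmorphM mulrC.
Qed.

Lemma lin_ext_star (M N : choiceType) (s : M -> M) (s' : N -> N)
    (h : M -> malg N C) :
  involutive s -> involutive s' -> (forall w, h (s w) = star s' (h w)) ->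
  forall x, lin_ext h (star s x) = star s' (lin_ext h x).
Proof.
move=> sK sK' hs; elim/malg_ind => [|x y IHx IHy|w c].
- by rewrite (star0 sK) lin_ext0 (star0 sK').
- by rewrite (starD sK) 2!lin_extD (starD sK') IHx IHy.
by rewrite (starU sK) 2!lin_extU hs (starZ sK').
Qed.

Lemma tensorU (M N : choiceType) (u : M) (v : N) a b :
  tensor (mkmalgU u a) (mkmalgU v b) = mkmalgU (u, v) (a * b).
Proof.
apply/malgP => -[u' v']; rewrite mcoeff_tensor !mcoeffU xpair_eqE.
by rewrite -mulnb mulrnA mulrnAr mulrnAl.
Qed.

Lemma tensorDl (M N : choiceType) (y : malg N C) :
  {morph (@tensor M N)^~ y : x x' / x + x'}.
Proof.
by move=> x x'; apply/malgP => -[u v];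
  rewrite mcoeffD !mcoeff_tensor mcoeffD mulrDl.
Qed.

Lemma tensorDr (M N : choiceType) (x : malg M C) :
  {morph @tensor M N x : y y' / y + y'}.
Proof.
by move=> y y'; apply/malgP => -[u v];
  rewrite mcoeffD !mcoeff_tensor mcoeffD mulrDr.
Qed.

Lemma tensorZl (M N : choiceType) c (x : malg M C) (y : malg N C) :
  tensor (c *: x) y = c *: tensor x y.
Proof.
by apply/malgP => -[u v]; rewrite mcoeffZ !mcoeff_tensor mcoeffZ mulrA.
Qed.

Lemma tensorZr (M N : choiceType) c (x : malg M C) (y : malg N C) :
  tensor x (c *: y) = c *: tensor x y.
Proof.
by apply/malgP => -[u v]; rewrite mcoeffZ !mcoeff_tensor mcoeffZ mulrCA.
Qed.

Lemma tensor11 (M N : monomType) : tensor (1 : malg M C) (1 : malg N C) = 1.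
Proof. by rewrite tensorU mulr1. Qed.

Lemma tensorM (M N : monomType) (x x' : malg M C) (y y' : malg N C) :
  tensor x y * tensor x' y' = tensor (x * x') (y * y').
Proof.
have tl0 (z : malg N C) : tensor (0 : malg M C) z = 0.
  by rewrite -(scale0r 0) tensorZl scale0r.
have tr0 (z : malg M C) : tensor z (0 : malg N C) = 0.
  by rewrite -(scale0r 0) tensorZr scale0r.
elim/malg_ind: x => [|x1 x2 IH1 IH2|u a]; first by rewrite !(mul0r, tl0).
  by rewrite tensorDl !mulrDl tensorDl IH1 IH2.
elim/malg_ind: x' => [|x1 x2 IH1 IH2|u' a'].
- by rewrite tl0 !mulr0 tl0.
- by rewrite tensorDl !mulrDr tensorDl IH1 IH2.
elim/malg_ind: y => [|y1 y2 IH1 IH2|v b]; first by rewrite tr0 !mul0r tr0.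
  by rewrite tensorDr !mulrDl tensorDr IH1 IH2.
elim/malg_ind: y' => [|y1 y2 IH1 IH2|v' b']; first by rewrite tr0 !mulr0 tr0.
  by rewrite tensorDr !mulrDr tensorDr IH1 IH2.
by rewrite !tensorU !mulUU tensorU mulrACA.
Qed.

Lemma star_tensor (M N : choiceType) (s : M -> M) (s' : N -> N) x y :
  involutive s -> involutive s' ->
  star (fun w => (s w.1, s' w.2)) (tensor x y) = tensor (star s x) (star s' y).
Proof.
move=> sK sK'; apply/malgP => -[u v].
by rewrite mcoeff_star ?mcoeff_tensor ?mcoeff_star ?rmorphM //= => -[a b] /=;
  rewrite sK sK'.
Qed.
End MonoidAlgebra.

Definition word_star (L : choiceType) (s : L -> L) (w : fmonom L) : fmonom L :=
  FMonom (rev (map s w)).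

(* Over a set G of generators, (g, false) is the letter g and (g, true) is    *)
(* the letter g^*.                                                            *)
Definition letter_star (G : choiceType) (a : G * bool) : G * bool :=
  (a.1, ~~ a.2).

(* A_1 * A_2 is the free algebra on the disjoint union of the two alphabets.  *)
Definition letter2_star (G1 G2 : choiceType) (c : G1 * bool + G2 * bool) :
    G1 * bool + G2 * bool :=
  match c with
  | inl a => inl (letter_star a)
  | inr b => inr (letter_star b)
  end.

Notation free_star_alg C G := (malg (fmonom (G * bool)%type) C).
Notation free_prod C G1 G2 :=
  (malg (fmonom (G1 * bool + G2 * bool)%type) C).

(* A * C[t] is the free algebra on the letters of A and one more letter t,    *)
(* here None.                                                                 *)
Notation tword G := (fmonom (option (G * bool))).
Notation tilde_alg C G := (malg (tword G) C).
Notation tensor_word m G1 G2 :=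
  ({ffun 'I_m -> tword G1} * {ffun 'I_m -> tword G2})%type.
Notation tensor_alg C m G1 G2 := (malg (tensor_word m G1 G2) C).

Definition tword_star (G : choiceType) : tword G -> tword G :=
  word_star (omap (@letter_star G)).

Definition tpow_star m (G : choiceType) (f : {ffun 'I_m -> tword G}) :
    {ffun 'I_m -> tword G} := [ffun i => tword_star (f i)].

Definition tensor_word_star m (G1 G2 : choiceType) (w : tensor_word m G1 G2) :
    tensor_word m G1 G2 := (tpow_star w.1, tpow_star w.2).

Lemma word_starK (L : choiceType) (s : L -> L) :
  involutive s -> involutive (word_star s).
Proof.
by move=> sK [w]; rewrite /word_star /= map_rev revK mapK.
Qed.

Lemma word_starM (L : choiceType) (s : L -> L) :
  {morph @word_star L s : u v / mmul u v >-> mmul v u}.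
Proof. by move=> u v; apply/val_inj; rewrite /= !fmM /= map_cat rev_cat. Qed.

Lemma letter_starK (G : choiceType) : involutive (@letter_star G).
Proof. by case=> g b; rewrite /letter_star /= negbK. Qed.

Lemma letter2_starK (G1 G2 : choiceType) : involutive (@letter2_star G1 G2).
Proof. by case=> a /=; rewrite letter_starK. Qed.

Lemma tword_starK (G : choiceType) : involutive (@tword_star G).
Proof. by apply: word_starK; case=> //= a; rewrite letter_starK. Qed.

Lemma tpow_starK m (G : choiceType) : involutive (@tpow_star m G).
Proof. by move=> f; apply/ffunP => i; rewrite !ffunE tword_starK. Qed.

Lemma tpow_starM m (G : choiceType) :
  {morph @tpow_star m G : u v / mmul u v >-> mmul v u}.
Proof.
by move=> u v; apply/ffunP => i; rewrite !ffunE /tword_star word_starM.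
Qed.

Lemma tensor_word_starK m (G1 G2 : choiceType) :
  involutive (@tensor_word_star m G1 G2).
Proof. by move=> [u v]; rewrite /tensor_word_star !tpow_starK. Qed.

Lemma tensor_word_starM m (G1 G2 : choiceType) :
  {morph @tensor_word_star m G1 G2 : u v / mmul u v >-> mmul v u}.
Proof.
by move=> u v; rewrite /tensor_word_star !tpow_starM.
Qed.

Definition is_free_state (C : numClosedFieldType) (G : choiceType)
    (phi : {scalar free_star_alg C G}) : Prop :=
  is_state (word_star (@letter_star G)) phi.

(* The factors, possibly empty, that are separated by the letters t: if       *)
(* w = u_0 t u_1 t ... t u_r with no t in the u_j, then                       *)
(* tblocks w = [:: u_0; ...; u_r].                                            *)
Fixpoint tblocks (L : Type) (w : seq (option L)) : seq (seq L) :=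
  match w with
  | [::] => [:: [::]]
  | None :: w' => [::] :: tblocks w'
  | Some a :: w' => (a :: head [::] (tblocks w')) :: behead (tblocks w')
  end.

Lemma tblocks_word (L : Type) (u : seq L) : tblocks (map Some u) = [:: u].
Proof. by elim: u => //= a u ->. Qed.

Lemma tblocks_cat (L : Type) (u : seq L) (w : seq (option L)) :
  tblocks (map Some u ++ None :: w) = u :: tblocks w.
Proof. by elim: u => //= a u ->. Qed.

Section BooleanExtension.
Variables (C : numClosedFieldType) (G : choiceType).

Definition bool_ext_word (phi : free_star_alg C G -> C) (w : tword G) :
    C :=
  \prod_(u <- tblocks w | u != [::]) phi (base C (FMonom u)).

Definition bool_ext (phi : free_star_alg C G -> C) :
    tilde_alg C G -> C^o :=
  lin_ext (bool_ext_word phi : _ -> C^o).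
End BooleanExtension.

Section TensorState.
Variables (C : numClosedFieldType) (m : nat).

(* The functional f (x) g^(x) (m-1) on the basis of the m-th tensor power.    *)
Definition first_rest (M : choiceType) (f g : malg M C -> C)
    (u : {ffun 'I_m -> M}) : C :=
  \prod_(i < m) (if i == 0 :> nat then f else g) (base C (u i)).

Definition tensor_state (G1 G2 : choiceType)
    (phi1 psi1 : free_star_alg C G1 -> C)
    (phi2 psi2 : free_star_alg C G2 -> C) :
    tensor_alg C m G1 G2 -> C^o :=
  lin_ext (fun w : tensor_word m G1 G2 =>
    first_rest (bool_ext phi1) (bool_ext psi1) w.1 *
    first_rest (bool_ext phi2) (bool_ext psi2) w.2 : C^o).
End TensorState.

Section Homomorphism.
Variables (C : numClosedFieldType) (m : nat).

(* Positions k are counted from 1, so that k corresponds to the index         *)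
(* i : 'I_m with i.+1 = k.                                                    *)
Definition leg (M : monomType) (k : nat) (x : malg M C) :
    malg {ffun 'I_m -> M} C :=
  if (k <= m)%N
  then lin_ext (fun w : M =>
         base C [ffun i : 'I_m => if i.+1 == k then w else mone]) x
  else 0.

Lemma leg_base (M : monomType) k (w : M) : (k <= m)%N ->
  leg k (base C w) = base C [ffun i : 'I_m => if i.+1 == k then w else mone].
Proof. by rewrite /leg => ->; rewrite lin_ext_base. Qed.

Lemma leg_gt (M : monomType) k (x : malg M C) : (m < k)%N -> leg k x = 0.
Proof. by rewrite /leg ltnNge => /negPf ->. Qed.

Definition t_from (G : choiceType) (k : nat) :
    malg {ffun 'I_m -> tword G} C :=
  base C [ffun i : 'I_m => if (k <= i.+1)%N then fmu None else mone].

Variables G1 G2 : choiceType.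

Definition j1 (a : G1 * bool) : tensor_alg C m G1 G2 :=
  \sum_(1 <= k < m.+1)
    tensor (leg k (base C (fmu (Some a))) - leg k.+1 (base C (fmu (Some a))))
           (t_from G2 k).

Definition j2 (b : G2 * bool) : tensor_alg C m G1 G2 :=
  \sum_(1 <= k < m.+1)
    tensor (t_from G1 k)
           (leg k (base C (fmu (Some b))) - leg k.+1 (base C (fmu (Some b)))).

Definition j_letter (c : G1 * bool + G2 * bool) : tensor_alg C m G1 G2 :=
  match c with inl a => j1 a | inr b => j2 b end.

Definition j_word (w : fmonom (G1 * bool + G2 * bool)%type) :
    tensor_alg C m G1 G2 :=
  \prod_(c <- (w : seq _)) j_letter c.

Definition jhom : free_prod C G1 G2 -> tensor_alg C m G1 G2 := lin_ext j_word.

Lemma jhom1 : jhom 1 = 1.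
Proof. by apply: lin_ext1; rewrite /j_word fm1 big_nil. Qed.

Lemma jhomM : {morph jhom : x y / x * y}.
Proof. by apply: lin_extM => u v; rewrite /j_word fmM big_cat. Qed.

Lemma jhomZ c x : jhom (c *: x) = c *: jhom x.
Proof. by rewrite /jhom lin_extZ. Qed.

Lemma jhomD : {morph jhom : x y / x + y}.
Proof. by move=> x y; rewrite /jhom lin_extD. Qed.

Lemma jhom_letter c : jhom (base C (fmu c)) = j_letter c.
Proof. by rewrite /jhom lin_ext_base /j_word fmU big_seq1. Qed.

Let tws1 (G : choiceType) : tword_star (mone : tword G) = mone.
Proof. by apply/val_inj; rewrite /= fm1. Qed.

Let twsU (G : choiceType) (a : option (G * bool)) :
  tword_star (fmu a) = fmu (omap (@letter_star G) a).
Proof. by apply/val_inj; rewrite /= !fmU. Qed.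

Lemma star_t_from (G : choiceType) k : star (@tpow_star m G) (t_from G k) = t_from G k.
Proof.
rewrite (star_base _ (@tpow_starK m G)); congr (base _ _); apply/ffunP => i; rewrite !ffunE.
by case: ifP => _; rewrite ?twsU ?tws1.
Qed.

Lemma star_leg_letter (G : choiceType) k (a : G * bool) :
  star (@tpow_star m G) (leg k (base C (fmu (Some a)))) =
  leg k (base C (fmu (Some (letter_star a)))).
Proof.
have [km|mk] := leqP k m; last by rewrite !leg_gt // (star0 _ (@tpow_starK m G)).
rewrite !leg_base // (star_base _ (@tpow_starK m G)); congr (base _ _).
apply/ffunP => i.
by rewrite !ffunE; case: ifP => _; rewrite ?twsU ?tws1.
Qed.

Let star_tensor_word x y :
  star (@tensor_word_star m G1 G2) (tensor x y) =
  tensor (star (@tpow_star m G1) x) (star (@tpow_star m G2) y) :> malg _ C.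
Proof. exact: star_tensor (@tpow_starK m G1) (@tpow_starK m G2). Qed.

Lemma star_j_letter c :
  star (@tensor_word_star m G1 G2) (j_letter c) = j_letter (letter2_star c).
Proof.
have tK := @tensor_word_starK m G1 G2.
have [K1 K2] := (@tpow_starK m G1, @tpow_starK m G2).
case: c => a; rewrite /j_letter /= (star_sum tK); apply: eq_bigr => k _.
  rewrite star_tensor_word star_t_from (starD K1) (starN K1).
  by rewrite (star_leg_letter k) (star_leg_letter k.+1).
rewrite star_tensor_word star_t_from (starD K2) (starN K2).
by rewrite (star_leg_letter k) (star_leg_letter k.+1).
Qed.

Let star_j_word w :
  star (@tensor_word_star m G1 G2) (j_word w) =
  j_word (word_star (@letter2_star G1 G2) w).
Proof.
have tK := @tensor_word_starK m G1 G2.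
have tM := @tensor_word_starM m G1 G2.
rewrite /j_word; case: w => w /=; elim: w => [|a w IH].
  rewrite big_nil -base1 (star_base _ tK) /=; congr (base _ _); congr (_, _);
    by apply/ffunP => i; rewrite !ffunE tws1.
rewrite /= rev_cons -cats1 big_cat big_seq1 big_cons /= -IH.
by rewrite (starM tK tM) star_j_letter.
Qed.

Lemma jhom_star x :
  jhom (star (word_star (@letter2_star G1 G2)) x) =
  star (@tensor_word_star m G1 G2) (jhom x).
Proof.
by apply: lin_ext_star => // w; [exact: word_starK (@letter2_starK G1 G2) w |
  exact: tensor_word_starK | rewrite star_j_word].
Qed.
End Homomorphism.

Section CondFree.
Variables (C : numClosedFieldType) (G1 G2 : choiceType).
Notation A1 := (free_star_alg C G1).
Notation A2 := (free_star_alg C G2).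

Definition iota1 : A1 -> free_prod C G1 G2 :=
  lin_ext (fun w : fmonom (G1 * bool)%type =>
    base C (FMonom (map inl w) : fmonom (G1 * bool + G2 * bool)%type)).

Definition iota2 : A2 -> free_prod C G1 G2 :=
  lin_ext (fun w : fmonom (G2 * bool)%type =>
    base C (FMonom (map inr w) : fmonom (G1 * bool + G2 * bool)%type)).

Definition iota (z : A1 + A2) : free_prod C G1 G2 :=
  match z with inl a => iota1 a | inr b => iota2 b end.

Definition eval2 (f1 : A1 -> C) (f2 : A2 -> C) (z : A1 + A2) : C :=
  match z with inl a => f1 a | inr b => f2 b end.

Definition other_side (y z : A1 + A2) : bool :=
  match y, z with inl _, inr _ | inr _, inl _ => true | _, _ => false end.

(* Phi is the conditionally free product of (phi1, psi1) and (phi2, psi2);    *)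
(* s lists the factors a_1, ..., a_n, each tagged with its index k_j.         *)
Definition is_cond_free (phi1 psi1 : {scalar A1}) (phi2 psi2 : {scalar A2})
    (Phi : {scalar free_prod C G1 G2}) : Prop :=
  is_state (word_star (@letter2_star G1 G2)) Phi /\
  forall s : seq (A1 + A2),
    sorted other_side s ->
    {in s, forall z, eval2 psi1 psi2 z = 0} ->
    Phi (\prod_(z <- s) iota z) = \prod_(z <- s) eval2 phi1 phi2 z.
End CondFree.

(* Main.v *)
Require Import Defs.
From HB Require Import structures.
From mathcomp Require Import all_boot all_order all_algebra.
From mathcomp Require Import finmap.
From mathcomp Require Import all_classical all_reals topology normedtype.
From mathcomp Require Import complex.
From mathcomp Require Import -(notations) monalg.

Set Implicit Arguments.
Unset Strict Implicit.
Unset Printing Implicit Defensive.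

Import Order.TTheory GRing.Theory Num.Theory.
Import numFieldNormedType.Exports.

Local Open Scope ring_scope.
Local Open Scope classical_set_scope.

(** The functionals are not merely convergent: at each x they are eventually
constant in m.  The reason is that each factor of an alternating product acts
on a single site of the tensor product, and on a new site every time.

Write a functional on the tensor product as a row vector, on which the algebra
acts from the right: x sends L to L (x * -).  For the Boolean extension of a
state, t acts on the vacuum row vector as the projection onto it, because
cutting a word at t makes the functional multiplicative.  Call a site excited
if its row vector is orthogonal to the vacuum: it kills the unit and every
multiple t w.  Only product row vectors occur, with a left family F and a right
family G of one-site functionals.

Suppose that in G all sites from k on are in the vacuum and that the site just
before k, if there is one, is excited.  Then t_[l] fixes G for l beyond that
excited site and kills it otherwise, so the sum that defines j_1(a) telescopes
to the single operator a at the first free site k of F ([row_j1]).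
The same holds, by linearity, for every z of A_1, unit included.

Now let z_1 ... z_n be an alternating product of psi-centered elements, and
take m >= n.  The first factor meets the vacuum at the first site and splits
into phi(z_1) times the vacuum plus an excited part.  On the excited part z_2
acts at the second site of the other leg, where the state is psi; as
psi(z_2) = 0 this site becomes excited too, and so on: each factor excites a
fresh site, and the final vector is orthogonal to the vacuum
([row_excited_prod]).  Hence the value is phi(z_1) times the value at
z_2 ... z_n, that is, the product of the phi(z_i) ([row_vac_prod]).  These
products span the free product ([span_alternating]), so equality with the
conditionally free product, for all large m, holds everywhere. *)

(** * Linear maps on monoid algebras *)

Section MonoidAlgebra.
Variable C : numClosedFieldType.

Lemma base_ind (M : monomType) (P : malg M C -> Prop) :
  (forall w, P (base C w)) ->
  (forall c x y, P x -> P y -> P (c *: x + y)) -> forall x, P x.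
Proof.
move=> Pb PL.
have P0 : P 0 by rewrite -(addNr (base C mone)) -scaleN1r; exact: PL.
apply: malg_ind => [//|x y Px Py|w c].
  by rewrite -[x]scale1r; apply: PL.
by rewrite -[mkmalgU w c]addr0 -[c]mulr1 -scaleU; exact: PL (Pb w) P0.
Qed.

Lemma linear_eq (M : monomType) (V : lmodType C) (f g : malg M C -> V) :
  linear f -> linear g -> (forall w, f (base C w) = g (base C w)) ->
  forall x, f x = g x.
Proof.
by move=> fL gL fg; elim/base_ind => // c x y IHx IHy; rewrite fL gL IHx IHy.
Qed.

Lemma lin_extP (M : choiceType) (V : lmodType C) (h : M -> V) c x y :
  lin_ext h (c *: x + y) = c *: lin_ext h x + lin_ext h y.
Proof. exact: linearP. Qed.

Lemma lin_ext_tensor (M N : choiceType) (f : M -> C) (g : N -> C) x y :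
  lin_ext (fun w : M * N => f w.1 * g w.2 : C^o) (tensor x y) =
  lin_ext (f : M -> C^o) x * lin_ext (g : N -> C^o) y.
Proof.
rewrite linear_sum /= mulr_suml; apply: eq_bigr => u _.
rewrite linear_sum /= mulr_sumr; apply: eq_bigr => v _.
by rewrite lin_extU /= mulrACA.
Qed.

End MonoidAlgebra.

(** * Product row vectors and the telescoping of j_1 *)

Section RowVectors.
Variables (C : numClosedFieldType) (m : nat).

Definition upd (T : Type) (F : nat -> T) (k : nat) (h : T) (i : nat) : T :=
  if i == k then h else F i.

Lemma upd_id (T : Type) (F : nat -> T) k : upd F k (F k) = F.
Proof. by apply/funext => i; rewrite /upd; case: eqP => [->|]. Qed.

(** The families are indexed by nat and not by the sites below m, so that the
states of the sites can be described without reference to m. *)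
Definition site_prod (M : choiceType) (F : nat -> M -> C)
    (f : {ffun 'I_m -> M}) : C := \prod_(i < m) F i (f i).

Lemma site_prod_upd (M : choiceType) (F : nat -> M -> C) k h
    (km : (k < m)%N) f :
  site_prod (upd F k h) f =
  h (f (Ordinal km)) * \prod_(i < m | i != Ordinal km) F i (f i).
Proof.
rewrite /site_prod (bigD1 (Ordinal km)) //= /upd eqxx; congr (_ * _).
by apply: eq_bigr => i; rewrite -val_eqE /= => /negPf ->.
Qed.

Lemma site_prod_leg (M : monomType) (F : nat -> M -> C) k w f : (k < m)%N ->
  lin_ext (site_prod F : _ -> C^o) (leg m k.+1 (base C w) * base C f) =
  site_prod (upd F k (fun v => F k (mmul w v))) f.
Proof.
move=> km; rewrite leg_base // -baseM lin_ext_base; apply: eq_bigr => i _.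
rewrite !ffunE eqSS /upd; case: eqP => [->//|_].
by rewrite mul1m.
Qed.

Section Row.
Variables (G1 G2 : choiceType).

(** The product functional on the tensor algebra with one-site factors F on the
left leg and G on the right leg: the row vector of the introduction. *)
Definition row (F : nat -> tword G1 -> C) (G : nat -> tword G2 -> C) :
    tensor_alg C m G1 G2 -> C^o :=
  lin_ext (fun w => site_prod F w.1 * site_prod G w.2 : C^o).

Lemma row_linear F G : linear (row F G).
Proof. exact: lin_ext_is_linear. Qed.

Lemma row_mulr_linear F G y : linear (fun x => row F G (y * x)).
Proof.
by move=> c x x'; rewrite mulrDr -malg_scalerAr; apply: row_linear.
Qed.

Lemma row_updl_lin F G k (c : C) h h' x : (k < m)%N ->
  row (upd F k (fun w => c * h w + h' w)) G x =
  c * row (upd F k h) G x + row (upd F k h') G x.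
Proof.
move=> km; move: x; apply: linear_eq => [||[f g]]; first exact: row_linear.
  move=> d x y; rewrite !row_linear /GRing.scale /= !mulrDr addrACA.
  by rewrite [d * (c * _)]mulrCA.
rewrite /row !lin_ext_base /= !(site_prod_upd _ _ km).
by rewrite mulrA mulrDl mulrDl !mulrA.
Qed.

End Row.

Section Frontier.
Variable G : choiceType.
Implicit Types (h : tword G -> C) (B F : nat -> tword G -> C).

(** Orthogonality to the vacuum vector, of which t is the projection. *)
Definition excited h := h mone = 0 /\ forall w, h (mmul (fmu None) w) = 0.

(** B is the family of vacua and k, counted from 0, the first free site.  The
sites before k - 1 may be in any state: the excitation at k - 1 already makes
t_[l] vanish for every l that reaches below k. *)
Definition frontier B (k : nat) F :=
  (forall i, (k <= i)%N -> F i = B i) /\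
  (if k is k'.+1 then excited (F k') else True).

(** t_[l] covers the sites l - 1, l, ... counted from 0.  If k < l these are all
in the vacuum, which t fixes; otherwise the excited site k - 1 is among them. *)
Lemma site_prod_t_from B F k l g :
  (forall i w, B i (mmul (fmu None) w) = B i w) ->
  frontier B k F -> (k < m)%N -> (0 < l)%N ->
  lin_ext (site_prod F : _ -> C^o) (t_from C m G l * base C g) =
  (k < l)%:R * site_prod F g.
Proof.
move=> Bt [FB Fk] km l0; rewrite -baseM lin_ext_base.
case: ltnP => [kl|lk]; rewrite ?(mul1r, mul0r).
  apply: eq_bigr => i _; rewrite !ffunE.
  case: ifP => [li|_]; last by rewrite mul1m.
  by rewrite FB // -ltnS (leq_trans kl).
(* Here l <= k and l > 0 force k > 0, so the site k - 1 exists. *)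
case: k Fk lk km {FB} => [|k] Fk lk km; first by case: l l0 lk.
have km' : (k < m)%N by exact: ltnW.
rewrite /site_prod (bigD1 (Ordinal km')) //= !ffunE /= lk.
by have [_ ->] := Fk; rewrite mul0r.
Qed.
End Frontier.

(** D l stands for the value with a at the site l, counted from 1; D (m + 1) = 0
is then the convention i_{m+1,m}(a) = 0. *)
Lemma telescope_from (D : nat -> C) k : (k < m)%N -> D m.+1 = 0 ->
  \sum_(1 <= l < m.+1) (D l - D l.+1) * (k < l)%:R = D k.+1.
Proof.
move=> km Dm; rewrite (big_cat_nat _ (n := k.+1)) //=; last exact: ltnW.
rewrite [X in X + _]big_nat_cond [X in X + _]big1 ?add0r; last first.
  by move=> l /andP[/andP[_ lk] _]; rewrite ltnNge -ltnS lk mulr0.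
under eq_big_nat => l /andP[kl _].
  rewrite kl mulr1 -[D l]opprK addrC; over.
by rewrite (telescope_sumr (fun l => - D l)) ?Dm ?oppr0 ?opprK ?add0r // ltnW.
Qed.

Section Letters.
Variables (G1 G2 : choiceType) (B2 : nat -> tword G2 -> C).
Hypothesis B2t : forall i w, B2 i (mmul (fmu None) w) = B2 i w.
Implicit Types (F : nat -> tword G1 -> C) (G : nat -> tword G2 -> C).

(** In the sum that defines j_1(a), the factor t_[l] on the right leg is 0 for
l <= k and 1 for l > k, so the differences on the left leg add up to a at the
single site k. *)
Lemma row_j1 F G k (a : G1 * bool) x : (k < m)%N -> frontier B2 k G ->
  row F G (j1 C m G2 a * x) =
  row (upd F k (fun w => F k (mmul (fmu (Some a)) w))) G x.
Proof.
move=> km Gk; move: x; apply: linear_eq => [||[f g]].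
- exact: row_mulr_linear.
- exact: row_linear.
have fgE : base C (f, g) = tensor (base C f) (base C g).
  by rewrite tensorU mulr1.
pose D l : C := lin_ext (site_prod F : _ -> C^o)
  (leg m l (base C (fmu (Some a))) * base C f).
have Dm : D m.+1 = 0 by rewrite /D leg_gt // mul0r lin_ext0.
rewrite [in RHS]/row lin_ext_base /= -(site_prod_leg F (fmu (Some a)) f km).
rewrite -/(D k.+1) -(telescope_from km Dm) fgE /j1.
rewrite 2!mulr_suml /row linear_sum.
apply: eq_big_nat => l /andP[l0 _].
rewrite /= tensorM lin_ext_tensor (site_prod_t_from g B2t Gk km l0).
by rewrite mulrBl linearB mulrA.
Qed.
End Letters.
End RowVectors.

(** * Exchange of the two legs *)

Section Swap.
Variables (C : numClosedFieldType) (m : nat) (G1 G2 : choiceType).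

(** The flip of the tensor product carries j_2 to j_1, so the second algebra
needs no separate computation. *)
Definition swap (x : tensor_alg C m G1 G2) : tensor_alg C m G2 G1 :=
  lin_ext (fun w => base C (w.2, w.1)) x.

Lemma swap_linear : linear swap.
Proof. exact: lin_ext_is_linear. Qed.

Lemma swapM : {morph swap : x y / x * y}.
Proof. by apply: lin_extM => u v; rewrite -baseM. Qed.

Lemma swap_tensor x y : swap (tensor x y) = tensor y x.
Proof.
rewrite /swap linear_sum /tensor exchange_big /=; apply: eq_bigr => v _.
rewrite linear_sum; apply: eq_bigr => u _.
by rewrite /= lin_extU /base scaleU mulr1 mulrC.
Qed.

Lemma swap_j2 b : swap (j2 C m G1 b) = j1 C m G1 b.
Proof.
rewrite /j2 /swap linear_sum; apply: eq_bigr => k _; exact: swap_tensor.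
Qed.

Lemma row_swap F G (x : tensor_alg C m G1 G2) : row G F (swap x) = row F G x.
Proof.
move: x; apply: linear_eq => [||[f g]]; last first.
- by rewrite /row /swap !lin_ext_base mulrC.
- exact: row_linear.
by move=> c x y; rewrite swap_linear; apply: row_linear.
Qed.
End Swap.

(** * Action of the elements of A_1 and A_2 on row vectors *)

Section Action.
Variables (C : numClosedFieldType) (m : nat) (G1 G2 : choiceType).

(** The right action of z on a one-site row vector. *)
Definition absorb (G : choiceType) (h : tword G -> C) (z : free_star_alg C G)
    (w : tword G) : C :=
  lin_ext (fun u : fmonom (G * bool)%type =>
    h (mmul (FMonom (map Some u)) w) : C^o) z.

Lemma jhom_linear : linear (@jhom C m G1 G2).
Proof. exact: lin_ext_is_linear. Qed.

Lemma iota1_linear : linear (@iota1 C G1 G2).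
Proof. exact: lin_ext_is_linear. Qed.

Lemma iota2_linear : linear (@iota2 C G1 G2).
Proof. exact: lin_ext_is_linear. Qed.

Lemma absorb_linear (G : choiceType) (h : tword G -> C) w :
  linear ((fun z => absorb h z w) : _ -> C^o).
Proof. exact: lin_ext_is_linear. Qed.

(** The right leg does not change while letters of A_1 act, so the telescoping
applies to each of them in turn, always at the site k. *)
Lemma row_j1_word F G B2 k (u : seq (G1 * bool)) x : (k < m)%N ->
  (forall i w, B2 i (mmul (fmu None) w) = B2 i w) -> frontier B2 k G ->
  row F G ((\prod_(a <- u) j1 C m G2 a) * x) =
  row (upd F k (fun w => F k (mmul (FMonom (map Some u)) w))) G x.
Proof.
move=> km B2t Gk; elim: u F => [|a u IH] F.
  rewrite big_nil mul1r -[in LHS](upd_id F k); congr (row (upd F k _) G x).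
  apply/funext => w; congr (F k _).
  by rewrite -[LHS]mul1m; congr mmul; apply/val_inj; rewrite /= fm1.
rewrite big_cons -mulrA (row_j1 B2t _ _ _ km Gk) IH; congr row.
apply/funext => i; rewrite /upd eqxx; case: eqP => // _.
apply/funext => w; congr (F k _); rewrite mulmA; congr mmul.
by apply/val_inj; rewrite /= fmM fmU.
Qed.

Lemma jhom_iota1 z : jhom m (iota1 G2 z) =
  lin_ext (fun u : fmonom (G1 * bool)%type =>
    \prod_(a <- (u : seq _)) j1 C m G2 a) z.
Proof.
move: z; apply: linear_eq => [||u]; last first.
- by rewrite /iota1 /jhom !lin_ext_base /j_word /= big_map.
- exact: lin_ext_is_linear.
by move=> c x y; rewrite iota1_linear; apply: jhom_linear.
Qed.

Lemma jhom_iota2 z : swap (jhom m (iota2 G1 z)) =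
  lin_ext (fun u : fmonom (G2 * bool)%type =>
    \prod_(b <- (u : seq _)) j1 C m G1 b) z.
Proof.
move: z; apply: linear_eq => [||u]; last first.
- rewrite /iota2 /jhom !lin_ext_base /j_word /= big_map.
  rewrite (big_morph _ (@swapM C m G1 G2) (lin_ext1 _)) //.
  by apply: eq_bigr => b _; rewrite swap_j2.
- exact: lin_ext_is_linear.
by move=> c x y; rewrite iota2_linear jhom_linear; apply: swap_linear.
Qed.

Lemma row_j1_alg F G B2 k z x : (k < m)%N ->
  (forall i w, B2 i (mmul (fmu None) w) = B2 i w) -> frontier B2 k G ->
  row F G (lin_ext (fun u : fmonom (G1 * bool)%type =>
    \prod_(a <- (u : seq _)) j1 C m G2 a) z * x) =
  row (upd F k (absorb (F k) z)) G x.
Proof.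
move=> km B2t Gk; move: z; apply: linear_eq => [||u]; last first.
- rewrite lin_ext_base (row_j1_word _ _ _ km B2t Gk); congr row.
  by apply/funext => i; rewrite /upd; congr (if _ then _ else _);
    apply/funext => w; rewrite /absorb lin_ext_base.
- move=> c y z; rewrite -[RHS]row_updl_lin //; congr row.
  apply/funext => i; rewrite /upd; congr (if _ then _ else _).
  by apply/funext => w; apply: absorb_linear.
by move=> c y z; rewrite lin_extP mulrDl -scalerAl row_linear.
Qed.

End Action.

(** * Boolean extensions: t as the vacuum projection *)

Section Boolean.
Variables (C : numClosedFieldType) (G : choiceType).
Implicit Types (phi psi : {scalar free_star_alg C G}).

Lemma bool_ext_word_t phi w :
  bool_ext_word phi (mmul (fmu None) w) = bool_ext_word phi w.
Proof. by rewrite /bool_ext_word fmM fmU big_cons. Qed.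

Lemma bool_ext_word1 phi : bool_ext_word phi mone = 1.
Proof. by rewrite /bool_ext_word fm1 /= big_cons big_nil. Qed.

Lemma lin_ext_scalar phi z :
  lin_ext (fun u => phi (base C u) : C^o) z = phi z.
Proof.
move: z; apply: linear_eq => [||u]; last by rewrite lin_ext_base.
- exact: lin_ext_is_linear.
- by move=> c y z; rewrite linearP.
Qed.

(** Empty blocks are skipped in the Boolean extension, which agrees with giving
them the value phi(1) = 1. *)
Lemma block_factor phi (u : fmonom (G * bool)%type) : phi 1 = 1 ->
  (if u != [::] :> seq _ then phi (base C (FMonom u)) else 1) = phi (base C u).
Proof.
move=> phi1; have -> : FMonom u = u by apply/val_inj.
case: u => -[|a u] //=; rewrite -phi1 -base1; congr (phi (base C _)).
by apply/val_inj; rewrite /= fm1.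
Qed.

Lemma absorb_bool_1 phi z : phi 1 = 1 ->
  absorb (bool_ext_word phi) z mone = phi z.
Proof.
move=> phi1; rewrite -[RHS]lin_ext_scalar /absorb; congr lin_ext.
apply/funext => u.
rewrite mulm1 /bool_ext_word /= tblocks_word big_mkcond big_seq1.
exact: block_factor.
Qed.

(** The Boolean extension of phi sends z t w to phi(z) times the value at w: a
letter t cuts the list of blocks. *)
Lemma absorb_bool_t phi z w : phi 1 = 1 ->
  absorb (bool_ext_word phi) z (mmul (fmu None) w) = phi z * bool_ext_word phi w.
Proof.
move=> phi1; move: z.
apply: (linear_eq (V := C^o) (g := fun z => phi z * bool_ext_word phi w)).
- exact: absorb_linear.
- by move=> c y z; rewrite linearP mulrDl /GRing.scale /= mulrA.
move=> u; rewrite /absorb lin_ext_base /bool_ext_word !fmM fmU tblocks_cat.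
by rewrite big_mkcond big_cons block_factor // -big_mkcond.
Qed.

Definition vac phi psi (i : nat) : tword G -> C :=
  bool_ext_word (if i == 0%N then phi else psi).

Lemma vac_t phi psi i w : vac phi psi i (mmul (fmu None) w) = vac phi psi i w.
Proof. exact: bool_ext_word_t. Qed.

(** On a vacuum of state psi, a psi-centered element leaves no vacuum component. *)
Lemma excited_centered psi z : psi 1 = 1 -> psi z = 0 ->
  excited (absorb (bool_ext_word psi) z).
Proof.
by move=> psi1 z0; split=> [|w]; rewrite ?absorb_bool_1 ?absorb_bool_t // z0 mul0r.
Qed.

(** The vacuum component of z acting on the vacuum is phi(z). *)
Lemma excited_sub phi z : phi 1 = 1 ->
  excited (fun w => absorb (bool_ext_word phi) z w - phi z * bool_ext_word phi w).
Proof.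
move=> phi1; split=> [|w].
  by rewrite absorb_bool_1 // bool_ext_word1 mulr1 subrr.
by rewrite absorb_bool_t // bool_ext_word_t subrr.
Qed.

Lemma frontier_vac phi psi : frontier (vac phi psi) 0 (vac phi psi).
Proof. by []. Qed.

Lemma frontier_upd (B F : nat -> tword G -> C) j k h : (j <= k)%N ->
  frontier B j F -> excited h -> frontier B k.+1 (upd F k h).
Proof.
move=> jk [FB _] hX; split; last by rewrite /upd eqxx.
by move=> i ki; rewrite /upd gtn_eqF // FB // (leq_trans jk) // ltnW.
Qed.

End Boolean.

(** * Alternating centered products *)

Section Limit.
Variables (C : numClosedFieldType) (G1 G2 : choiceType).
Variables (phi1 psi1 : {scalar free_star_alg C G1}).
Variables (phi2 psi2 : {scalar free_star_alg C G2}).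
Hypotheses (phi1_1 : phi1 1 = 1) (psi1_1 : psi1 1 = 1).
Hypotheses (phi2_1 : phi2 1 = 1) (psi2_1 : psi2 1 = 1).
Local Notation V1 := (vac phi1 psi1).
Local Notation V2 := (vac phi2 psi2).
Local Notation letter := (free_star_alg C G1 + free_star_alg C G2)%type.
Implicit Types (F : nat -> tword G1 -> C) (G : nat -> tword G2 -> C).
Implicit Types (z : letter) (s : seq letter).

Definition centered z := eval2 psi1 psi2 z = 0.

Section FixedSize.
Variable m : nat.

Lemma row_iota1 F G k a x : (k < m)%N -> frontier V2 k G ->
  row F G (jhom m (iota1 G2 a) * x) = row (upd F k (absorb (F k) a)) G x.
Proof.
move=> km Gk; rewrite jhom_iota1.
exact: row_j1_alg km (@vac_t _ _ phi2 psi2) Gk.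
Qed.

Lemma row_iota2 F G k b x : (k < m)%N -> frontier V1 k F ->
  row F G (jhom m (iota2 G1 b) * x) = row F (upd G k (absorb (G k) b)) x.
Proof.
move=> km Fk; rewrite -row_swap swapM jhom_iota2.
by rewrite (row_j1_alg _ _ _ km (@vac_t _ _ phi1 psi1) Fk) row_swap.
Qed.

(** The state of both legs after an element of the side of z has excited the
site k of its own leg, the frontier of the other leg being still k.  An element
of the other side then acts at the site k + 1. *)
Definition excited_by z k F G :=
  match z with
  | inl _ => frontier V1 k.+1 F /\ frontier V2 k G
  | inr _ => frontier V1 k F /\ frontier V2 k.+1 G
  end.

Lemma row_excited1 z k F G : (k < m)%N -> excited_by z k F G ->
  row F G (1 : tensor_alg C m G1 G2) = 0.
Proof.
move=> km zFG; rewrite -base1 /row lin_ext_base /= /site_prod.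
case: z zFG => _ [[_ Fk] [_ Gk]].
  by rewrite (bigD1 (Ordinal km)) //= ffunE (proj1 Fk) !mul0r.
by rewrite mulrC (bigD1 (Ordinal km)) //= ffunE (proj1 Gk) !mul0r.
Qed.

(** Each further factor acts on a fresh site, where the state is psi because the
site is not the first one, and excites it; so no vacuum component ever
reappears.  The bound on m leaves room for one site per factor. *)
Lemma row_excited_prod z k F G s :
  path (@other_side C G1 G2) z s -> {in s, forall y, centered y} ->
  (k + size s < m)%N -> excited_by z k F G ->
  row F G (jhom m (\prod_(y <- s) Defs.iota y)) = 0.
Proof.
elim: s z k F G => [|y s IH] z k F G /=.
  rewrite addn0 => _ _ km zFG.
  by rewrite big_nil jhom1; apply: row_excited1 zFG.
move=> /andP[zy ys] cs sm zFG.
have km : (k.+1 < m)%N.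
  by apply: leq_trans sm; rewrite !ltnS addnS ltnS leq_addr.
have cy : centered y by apply: cs; rewrite mem_head.
have cs' : {in s, forall y, centered y}.
  by move=> y' y's; apply: cs; rewrite inE y's orbT.
rewrite big_cons jhomM; rewrite -addSnnS in sm.
case: z zy zFG => ?; case: y ys cy {cs} => y ys cy //= _ [Fk Gk].
- rewrite (row_iota2 _ _ _ km Fk); apply: (IH (inr y) k.+1) => //=; split=> //.
  apply: (frontier_upd (leqnSn k)) => //; rewrite (proj1 Gk) //.
  exact: excited_centered.
- rewrite (row_iota1 _ _ _ km Gk); apply: (IH (inl y) k.+1) => //=; split=> //.
  apply: (frontier_upd (leqnSn k)) => //; rewrite (proj1 Fk) //.
  exact: excited_centered.
Qed.

(** The first factor z acts at the first site, whose state is phi: it yields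
phi(z) times the vacuum, and an excited part that contributes nothing. *)
Lemma row_vac_prod s : (size s <= m)%N ->
  sorted (@other_side C G1 G2) s -> {in s, forall z, centered z} ->
  row V1 V2 (jhom m (\prod_(z <- s) Defs.iota z)) =
  \prod_(z <- s) eval2 phi1 phi2 z.
Proof.
elim: s => [|z s IH] /= sm zs cs.
  rewrite !big_nil jhom1 -base1 /row lin_ext_base /= /site_prod.
  by rewrite !big1 ?mulr1 // => i _; rewrite ffunE /vac bool_ext_word1.
have cs' : {in s, forall y, centered y}.
  by move=> y ys; apply: cs; rewrite inE ys orbT.
have m0 : (0 < m)%N by exact: leq_ltn_trans sm.
rewrite !big_cons jhomM -(IH (ltnW sm) (path_sorted zs) cs').
set x := \prod_(y <- s) Defs.iota y.
case: z zs cs => [a|b] zs cs.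
- rewrite (row_iota1 _ _ _ m0 (frontier_vac _ _)).
  pose h w : C := absorb (V1 0%N) a w - phi1 a * V1 0%N w.
  have -> : absorb (V1 0%N) a = fun w => phi1 a * V1 0%N w + h w.
    by apply/funext => w; rewrite /h addrC subrK.
  rewrite row_updl_lin // upd_id (row_excited_prod (z := inl a) (k := 0)
    (F := upd V1 0 h)) ?addr0 //.
  split=> //; apply: (frontier_upd (leqnn 0)) => //; exact: excited_sub.
rewrite (row_iota2 _ _ _ m0 (frontier_vac _ _)).
pose h w : C := absorb (V2 0%N) b w - phi2 b * V2 0%N w.
have -> : absorb (V2 0%N) b = fun w => phi2 b * V2 0%N w + h w.
  by apply/funext => w; rewrite /h addrC subrK.
rewrite -row_swap row_updl_lin // !row_swap.
rewrite upd_id (row_excited_prod (z := inr b) (k := 0)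
  (G := upd V2 0 h)) ?addr0 //.
split=> //; apply: (frontier_upd (leqnn 0)) => //; exact: excited_sub.
Qed.

Lemma tensor_state_row x :
  tensor_state phi1 psi1 phi2 psi2 x = row V1 V2 (x : tensor_alg C m G1 G2).
Proof.
congr lin_ext; apply/funext => w; congr (_ * _); apply: eq_bigr => i _;
  by rewrite /vac; case: ifP => _; rewrite /bool_ext lin_ext_base.
Qed.
End FixedSize.

(** * Alternating centered products span the free product *)

Definition center z : letter :=
  match z with
  | inl a => inl (a - psi1 a *: 1)
  | inr b => inr (b - psi2 b *: 1)
  end.

Lemma centered_center z : centered (center z).
Proof.
by case: z => a; rewrite /centered /= linearB linearZ /= ?psi1_1 ?psi2_1;
  rewrite /GRing.scale /= mulr1 subrr.
Qed.

Lemma iota_center z : Defs.iota z = eval2 psi1 psi2 z *: 1 + Defs.iota (center z).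
Proof.
have i1 : iota1 G2 (1 : free_star_alg C G1) = 1.
  by apply: lin_ext1; rewrite -base1; congr base; apply/val_inj; rewrite /= !fm1.
have i2 : iota2 G1 (1 : free_star_alg C G2) = 1.
  by apply: lin_ext1; rewrite -base1; congr base; apply/val_inj; rewrite /= !fm1.
case: z => a /=.
  by rewrite -[in RHS]i1 -iota1_linear addrC subrK.
by rewrite -[in RHS]i2 -iota2_linear addrC subrK.
Qed.

Definition lin_closed (P : free_prod C G1 G2 -> Prop) :=
  forall c x y, P x -> P y -> P (c *: x + y).

Definition alternating s :=
  sorted (@other_side C G1 G2) s /\ {in s, forall z, centered z}.

(** If z and the first factor lie on different sides, center z; if on the same
side, multiply them first and center the product.  The correction is a scalar
multiple of a shorter alternating product. *)
Lemma span_letter (P : free_prod C G1 G2 -> Prop) z s : lin_closed P ->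
  (forall s, alternating s -> P (\prod_(y <- s) Defs.iota y)) ->
  alternating s -> P (Defs.iota z * \prod_(y <- s) Defs.iota y).
Proof.
move=> PL Ps.
have Pz z' s' : path (@other_side C G1 G2) z' s' ->
    {in s', forall z, centered z} ->
    P (Defs.iota z' * \prod_(y <- s') Defs.iota y).
  move=> zs cs; rewrite iota_center mulrDl -scalerAl mul1r; apply: PL.
    by apply: Ps; split=> //; exact: path_sorted zs.
  have -> : Defs.iota (center z') * \prod_(y <- s') Defs.iota y =
    \prod_(y <- center z' :: s') Defs.iota y by rewrite big_cons.
  apply: Ps; split=> [|y]; first by case: z' zs => z'; case: s' {cs} => [|[]].
  by rewrite inE => /orP[/eqP -> | /cs //]; apply: centered_center.
case: s => [|y s] [ys cs]; first exact: Pz.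
have [zy|zy] := boolP (other_side z y); first by apply: Pz => //=; rewrite zy.
have cs' : {in s, forall y, centered y}.
  by move=> y' y's; apply: cs; rewrite inE y's orbT.
rewrite big_cons mulrA.
case: z zy => a; case: y ys {cs} => b //= bs _.
  have -> : iota1 G2 a * iota1 G2 b = Defs.iota (inl (a * b)) :> free_prod C G1 G2.
    by rewrite /= /iota1 lin_extM // => u v; rewrite -baseM; congr (base _ _);
      apply/val_inj; rewrite /= !fmM map_cat.
  by apply: Pz => //; case: (s) bs => [|[]].
have -> : iota2 G1 a * iota2 G1 b = Defs.iota (inr (a * b)) :> free_prod C G1 G2.
  by rewrite /= /iota2 lin_extM // => u v; rewrite -baseM; congr (base _ _);
    apply/val_inj; rewrite /= !fmM map_cat.
by apply: Pz => //; case: (s) bs => [|[]].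
Qed.

(** By induction on words, taking the letters from the right: the induction
hypothesis says that P (w * -) holds on alternating products, and
[span_letter] applied to this predicate adds one letter. *)
Lemma span_alternating (P : free_prod C G1 G2 -> Prop) : lin_closed P ->
  (forall s, alternating s -> P (\prod_(z <- s) Defs.iota z)) -> forall x, P x.
Proof.
move=> PL Ps; apply: base_ind => // -[w].
suff Pw s : alternating s -> P (base C (FMonom w) * \prod_(z <- s) Defs.iota z).
  by have := Pw [::]; rewrite big_nil mulr1; apply.
elim/last_ind: w s => [|w c IH] s alts.
  have -> : base C (FMonom [::]) = 1 :> free_prod C G1 G2.
    by rewrite -base1; congr base; apply/val_inj; rewrite /= !fm1.
  by rewrite mul1r; apply: Ps.
pose z : letter := match c with
  inl a => inl (base C (fmu a)) | inr b => inr (base C (fmu b)) end.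
have -> : base C (FMonom (rcons w c)) = base C (FMonom w) * Defs.iota z.
  have -> : Defs.iota z = base C (fmu c).
    by case: c @z => c /=; rewrite /iota1 /iota2 lin_ext_base; congr base;
      apply/val_inj; rewrite /= !fmU.
  by rewrite -baseM; congr base; apply/val_inj; rewrite /= fmM fmU cats1.
rewrite -mulrA.
have PwL : lin_closed (fun y => P (base C (FMonom w) * y)).
  by move=> d x y Px Py; rewrite mulrDr -malg_scalerAr; apply: PL.
by have := span_letter z PwL IH alts; apply.
Qed.

(** * Stationarity and the limit *)

Lemma tensor_state_stationary (Phi : {scalar free_prod C G1 G2}) x :
  (forall s, alternating s ->
    Phi (\prod_(z <- s) Defs.iota z) = \prod_(z <- s) eval2 phi1 phi2 z) ->
  exists N, forall m, (N <= m)%N ->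
    tensor_state phi1 psi1 phi2 psi2 (jhom m x) = Phi x.
Proof.
move=> PhiE; apply: (span_alternating (P := fun x => exists N, forall m,
  (N <= m)%N -> tensor_state phi1 psi1 phi2 psi2 (jhom m x) = Phi x)).
  move=> c y z [N1 E1] [N2 E2]; exists (maxn N1 N2) => m.
  rewrite geq_max => /andP[/E1 {}E1 /E2 {}E2].
  rewrite tensor_state_row in E1; rewrite tensor_state_row in E2.
  rewrite linearP tensor_state_row jhom_linear row_linear.
  exact: (congr2 (fun u v : C^o => c *: u + v) E1 E2).
move=> s alts; exists (size s) => m sm.
by rewrite tensor_state_row PhiE //; case: alts => ss cs; apply: row_vac_prod.
Qed.
End Limit.

Theorem corollary4p3 (R : realType) (G1 G2 : choiceType)
    (phi1 psi1 : {scalar free_star_alg R[i] G1})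
    (phi2 psi2 : {scalar free_star_alg R[i] G2})
    (Phi : {scalar free_prod R[i] G1 G2}) :
  is_free_state phi1 -> is_free_state psi1 ->
  is_free_state phi2 -> is_free_state psi2 ->
  is_cond_free phi1 psi1 phi2 psi2 Phi ->
  forall x : free_prod R[i] G1 G2,
    tensor_state phi1 psi1 phi2 psi2 (jhom m x) @[m --> \oo]
      --> (Phi x : R[i]^o).
Proof.
move=> [phi1_1 _] [psi1_1 _] [phi2_1 _] [psi2_1 _] [_ PhiE] x.
have [|N xN] := tensor_state_stationary phi1_1 psi1_1 phi2_1 psi2_1 (Phi := Phi) x.
  by move=> s [ss cs]; apply: PhiE.
by apply: cvg_near_cst; exists N => // m /= /xN.
Qed.
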